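(* Let $m,d\in\mathbb N$ and consider the two-layer model $f_\theta(x)=\sum_{i=1}^m a_i\tanh(w_i^\top x)$, $x\in\mathbb R^d$, $\theta=(a_i,w_i)_{i=1}^m\in\mathbb R^{m(d+1)}$. For every integer $0\leq k\leq m$ and every $f^*\in\mathcal F^{\mathrm{NN}}_k\setminus\mathcal F^{\mathrm{NN}}_{k-1}$, the optimistic sample size is $O_{f_\theta}(f^* )=k(d+1)$.
   Context: For $k\geq1$, $\mathcal F^{\mathrm{NN}}_k=\{x\mapsto\sum_{i=1}^k a_i\tanh(w_i^\top x): a_i\in\mathbb R,\ w_i\in\mathbb R^d\}$; $\mathcal F^{\mathrm{NN}}_0=\{0\}$ (the zero function) and $\mathcal F^{\mathrm{NN}}_{-1}=\emptyset$. The loss $\ell:\mathbb R\times\mathbb R\to[0,\infty)$ is continuously differentiable with $\ell(u,v)=0$ iff $u=v$. For $f^*$ in the function space of $f_\theta$: $\mathcal M_{f^*}=\{\theta:f_\theta=f^*\}$; a dataset of size $n$ from $f^*$ is $\{(x_i,f^*(x_i))\}_{i=1}^n$ with empirical loss $\frac1n\sum_i\ell(u(x_i),f^*(x_i))$ for a function $u$ (identically $0$ if $n=0$); the tangent hyperplane at $\theta'$ is $\{f(\cdot;\theta')+a^\top\nabla_\theta f(\cdot;\theta'):a\in\mathbb R^{m(d+1)}\}$; $f^*$ has $n$-sample LLR-guarantee if for some dataset of size $n$ from $f^*$ and some $\theta'\in\mathcal M_{f^*}$ the set of minimizers of the empirical loss over the tangent hyperplane at $\theta'$ is exactly $\{f^*\}$;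 the optimistic sample size $O_{f_\theta}(f^* )$ is the smallest such $n\geq0$. *)

(* Defs.v *)
From HB Require Import structures.
From mathcomp Require Import all_boot all_order all_algebra.
From mathcomp Require Import all_classical all_reals all_analysis.
Unset Strict Implicit. Unset Printing Implicit Defensive.
Import Order.TTheory GRing.Theory Num.Theory.
Import numFieldNormedType.Exports.
Local Open Scope ring_scope.
Local Open Scope classical_set_scope.

Section Defs.
Context {R : realType}.

Definition tanh (z : R) : R := (expR z - expR (- z)) / (expR z + expR (- z)).

Definition dotp {d : nat} (w x : 'I_d -> R) : R := \sum_(j < d) w j * x j.

Definition nn {k d : nat} (a : 'I_k -> R) (w : 'I_k -> 'I_d -> R)
  (x : 'I_d -> R) : R := \sum_(i < k) a i * tanh (dotp (w i) x).

(* F^NN_k (for k = 0 the empty sum gives {0}) *)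
Definition FNN (d k : nat) : set (('I_d -> R) -> R) :=
  [set f | exists (a : 'I_k -> R) (w : 'I_k -> 'I_d -> R), f = nn a w].

Definition FNN_pred (d k : nat) : set (('I_d -> R) -> R) :=
  if k is k'.+1 then FNN d k' else set0.

Definition model {m d : nat} (a : 'I_m -> R) (w : 'I_m -> 'I_d -> R) :=
  nn a w.

Definition Mset (m d : nat) (fs : ('I_d -> R) -> R) :
  set (('I_m -> R) * ('I_m -> 'I_d -> R)) :=
  [set th | model th.1 th.2 = fs].

Definition dA {m d : nat} (a : 'I_m -> R) (w : 'I_m -> 'I_d -> R) (i : 'I_m)
  (x : 'I_d -> R) : R :=
  derive1 (fun t : R => model (fun i' => a i' + (i' == i)%:R * t) w x) 0.

Definition dW {m d : nat} (a : 'I_m -> R) (w : 'I_m -> 'I_d -> R) (i : 'I_m)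
  (j : 'I_d) (x : 'I_d -> R) : R :=
  derive1 (fun t : R => model a (fun i' j' => w i' j' + ((i' == i) && (j' == j))%:R * t) x) 0.

Definition tangent {m d : nat} (a : 'I_m -> R) (w : 'I_m -> 'I_d -> R) :
  set (('I_d -> R) -> R) :=
  [set u | exists (cA : 'I_m -> R) (cW : 'I_m -> 'I_d -> R),
     u = fun x => model a w x + \sum_(i < m) cA i * dA a w i x
                  + \sum_(i < m) \sum_(j < d) cW i j * dW a w i j x].

Definition emp_loss (l : R -> R -> R) {d n : nat} (X : 'I_n -> 'I_d -> R)
  (fs u : ('I_d -> R) -> R) : R :=
  if n == 0%N then 0 else n%:R^-1 * \sum_(i < n) l (u (X i)) (fs (X i)).

Definition minimizers {T : Type} (L : T -> R) (S : set T) : set T :=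
  [set u | S u /\ forall v, S v -> L u <= L v].

Definition LLR_guarantee (l : R -> R -> R) (m d n : nat)
  (fs : ('I_d -> R) -> R) : Prop :=
  exists (X : 'I_n -> 'I_d -> R) (th : ('I_m -> R) * ('I_m -> 'I_d -> R)),
    Mset m d fs th /\
    minimizers (emp_loss l X fs) (tangent th.1 th.2) = [set fs].

Definition optimistic_sample_size_is (l : R -> R -> R) (m d : nat)
  (fs : ('I_d -> R) -> R) (N : nat) : Prop :=
  LLR_guarantee l m d N fs /\ forall n, LLR_guarantee l m d n fs -> (N <= n)%N.

(* standing assumptions on the loss: l >= 0, C^1 on R x R
   (both partial derivatives exist everywhere and are jointly continuous),
   and l(u,v) = 0 iff u = v *)
Definition admissible_loss (l : R -> R -> R) : Prop :=
  [/\ forall u v, 0 <= l u v,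
      forall u v, l u v = 0 <-> u = v,
      forall u v, derivable (fun t => l t v) u 1 /\ derivable (fun t => l u t) v 1,
      continuous (fun p : R * R => derive1 (fun t => l t p.2) p.1) &
      continuous (fun p : R * R => derive1 (fun t => l p.1 t) p.2)].

End Defs.

(* Main.v *)
(* Both bounds rest on one independence statement: if u <> 0 and u <> +-u_i for all i, then
   tanh(u.x) and the x_j sech^2(u.x) are independent modulo the same functions built from the
   u_i.  Along a line x = t v in generic direction this becomes a statement in one variable,
   where, as t -> oo, the term with the smallest frequency mu dominates, of order
   (c + b t) exp(-2 mu t); frequencies are removed one at a time.
   Upper bound: pad a minimal representation of f* with zero neurons.  The tangent space is then
   spanned by k(d+1) independent functions, which are separated by k(d+1) suitable points.
   Lower bound: in any representation of f* each of the k minimal neurons occurs, up to sign, with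
   a nonzero output weight, so the tangent space contains k(d+1) independent functions; with fewer
   points some nonzero tangent direction vanishes on the sample and yields a second minimizer. *)
Require Import Defs.
From HB Require Import structures.
From mathcomp Require Import all_boot all_order all_algebra.
From mathcomp Require Import all_classical all_reals all_analysis.
From mathcomp Require Import ring lra.
Import Order.TTheory GRing.Theory Num.Theory.
Import numFieldNormedType.Exports.
Local Open Scope ring_scope.
Local Open Scope classical_set_scope.

(** * Exponential forms and derivatives of [tanh] and [sech2] *)

Definition sech2 {R : realType} (z : R) : R := 4 / (expR z + expR (- z)) ^+ 2.

Lemma expR_addN_neq0 {R : realType} (z : R) : expR z + expR (- z) != 0.
Proof. by rewrite lt0r_neq0 ?addr_gt0 ?expR_gt0. Qed.

Lemma tanhN {R : realType} (z : R) : tanh (- z) = - tanh z.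
Proof. by rewrite /tanh opprK -mulNr opprB [expR (- z) + expR z]addrC. Qed.

Lemma tanh0 {R : realType} : tanh (0 : R) = 0.
Proof. by rewrite /tanh oppr0 subrr mul0r. Qed.

Lemma sech2N {R : realType} (z : R) : sech2 (- z) = sech2 z.
Proof. by rewrite /sech2 opprK addrC. Qed.

Lemma tanhE_expR {R : realType} (z : R) :
  tanh z = 1 - 2 * expR (- (2 * z)) / (1 + expR (- (2 * z))).
Proof.
have -> : expR (- (2 * z)) = expR (- z) ^+ 2 by rewrite -expRM_natl; congr expR; ring.
have e0 := expR_gt0 z; rewrite /tanh expRN.
have n1 : expR z != 0 by rewrite gt_eqF.
have n2 : expR z ^+ 2 + 1 != 0 by rewrite gt_eqF // addr_gt0 // exprn_gt0.
by field; rewrite n1 -?expr2 ?n2 ?[1 + _]addrC ?n2 andbT.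
Qed.

Lemma sech2E_expR {R : realType} (z : R) :
  sech2 z = 4 * expR (- (2 * z)) / (1 + expR (- (2 * z))) ^+ 2.
Proof.
have -> : expR (- (2 * z)) = expR (- z) ^+ 2 by rewrite -expRM_natl; congr expR; ring.
have e0 := expR_gt0 z; rewrite /sech2 expRN.
have n1 : expR z != 0 by rewrite gt_eqF.
have n2 : expR z ^+ 2 + 1 != 0 by rewrite gt_eqF // addr_gt0 // exprn_gt0.
by field; rewrite n1 -?expr2 ?n2 ?[1 + _]addrC ?n2 andbT.
Qed.

Lemma is_derive_tanh {R : realType} (z : R) : is_derive z 1 tanh (sech2 z).
Proof.
have dN : is_derive z 1 (fun y : R => expR (- y)) (- expR (- z)).
  have -> : - expR (- z) = expR (- z) * (- 1) :> R by rewrite mulrN1.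
  by apply: (is_derive1_comp (f := expR) (g := -%R)).
have dD : is_derive z 1 (fun y : R => expR y + expR (- y)) (expR z - expR (- z)).
  exact: (is_deriveD (is_derive_expR z) dN).
have dV := @is_deriveV _ (fun y : R => expR y + expR (- y)) _ _ _ (expR_addN_neq0 z) dD.
have := is_deriveM (is_deriveB (is_derive_expR z) dN) dV.
move=> h; apply: (is_derive_eq h).
rewrite /GRing.scale /= /sech2.
have := expR_addN_neq0 z; have := mulfV (expR_addN_neq0 z).
have : expR z * expR (- z) = 1 by rewrite -expRD subrr expR0.
rewrite !fctE; set a := expR z; set b := expR (- z) => ab _ n0.
(* The quotient rule leaves [(a + b)^2 - (a - b)^2 = 4ab] in the numerator, and [ab = 1]. *)
have -> : 4 = 4 * (a * b) :> R by rewrite ab mulr1.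
by field.
Qed.

Lemma derive1_affine_tanh {R : realType} (c a s y : R) :
  derive1 (fun t : R => c + a * tanh (s + y * t)) 0 = a * (y * sech2 s).
Proof.
rewrite derive1E; apply: derive_val.
pose g (t : R) := s + y * t.
have dl : is_derive (0 : R) 1 g y.
  have := is_deriveD (is_derive_cst s (0 : R) 1) (is_deriveZ y (is_derive_id (0 : R) 1)).
  move=> h; apply: (is_derive_eq h).
by rewrite add0r /GRing.scale /= mulr1.
have ts : is_derive (g 0) 1 tanh (sech2 s).
  by rewrite /g mulr0 addr0; apply: is_derive_tanh.
have := is_deriveD (is_derive_cst c (0 : R) 1) (is_deriveZ a (is_derive1_comp ts dl)).
move=> h; apply: (is_derive_eq h).
by rewrite add0r /GRing.scale /= [sech2 s * y]mulrC.
Qed.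

Lemma derive1_affine {R : realType} (c a : R) :
  derive1 (fun t : R => c + a * t) 0 = a.
Proof.
rewrite derive1E; apply: derive_val.
have := is_deriveD (is_derive_cst c (0 : R) 1) (is_deriveZ a (is_derive_id (0 : R) 1)).
move=> h; apply: (is_derive_eq h).
by rewrite add0r /GRing.scale /= mulr1.
Qed.

(** * Independence in one variable, from asymptotics along the integers *)

Lemma cvg_expRNM {R : realType} (nu : R) : 0 < nu ->
  expR (- (nu * n%:R)) @[n --> \oo] --> (0 : R).
Proof.
move=> nu0.
under eq_fun do rewrite -mulNr expRM_natr.
apply: cvg_expr.
by rewrite ger0_norm ?expR_ge0 // -[ltRHS]expR0 ltr_expR oppr_lt0.
Qed.

(** Half of the decay absorbs the factor [n], because [nu / 2 * n <= exp (nu / 2 * n)]. *)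
Lemma cvg_natr_expRNM {R : realType} (nu : R) : 0 < nu ->
  n%:R * expR (- (nu * n%:R)) @[n --> \oo] --> (0 : R).
Proof.
move=> nu0; have nu20 : 0 < nu / 2 by rewrite divr_gt0.
have h : (nu / 2)^-1 * expR (- (nu / 2 * n%:R)) @[n --> \oo] --> (0 : R).
  by rewrite -(mulr0 (nu / 2)^-1); apply: cvgMr; apply: cvg_expRNM.
apply: (squeeze_cvgr _ (cvg_cst 0) h); near=> n.
rewrite mulr_ge0 ?expR_ge0 //=.
have -> : expR (- (nu * n%:R)) = expR (- (nu / 2 * n%:R)) * expR (- (nu / 2 * n%:R)).
  by rewrite -expRD; congr expR; field.
rewrite mulrA ler_pM2r ?expR_gt0 // expRN ler_pdivrMr ?expR_gt0 //.
rewrite ler_pdivlMl //; apply: le_trans (expR_ge1Dx _).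
by rewrite lerDr.
Unshelve. all: by end_near. Qed.

(** Consecutive values of [r] differ by [B], which is therefore the limit of a null sequence; then
    [r] is constantly [- A]. *)
Lemma affine_cvg0 {R : realType} (A B : R) (r : nat -> R) :
  (forall n, A + B * n%:R + r n = 0) -> r n @[n --> \oo] --> (0 : R) ->
  A = 0 /\ B = 0.
Proof.
move=> rE r0.
have rS : r n.+1 @[n --> \oo] --> (0 : R) by rewrite (cvg_shiftS r (nbhs (0 : R))).
have B0 : B = 0.
  have BE : (fun n => r n - r n.+1) = fun=> B.
    apply/funext => n; have := rE n; have := rE n.+1; rewrite -natr1; lra.
  have := cvgB r0 rS; rewrite subr0 => h.
  have h2 : B @[n --> \oo] --> (0 : R) by rewrite -BE; exact: h.
  by have := cvg_unique _ (cvg_cst B : B @[n --> \oo] --> B) h2; apply.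
split => //.
have AE : (fun n => - r n) = fun=> A.
  by apply/funext => n; have := rE n; rewrite B0 mul0r; lra.
have := cvgN r0; rewrite oppr0 => h.
have h2 : A @[n --> \oo] --> (0 : R) by rewrite -AE; exact: h.
by have := cvg_unique _ (cvg_cst A : A @[n --> \oo] --> A) h2; apply.
Qed.

(* The two summands are, up to affine changes, [tanh (mu n)] and [n sech2 (mu n)]. *)
Definition expo_term {R : realType} (c b mu : R) (n : nat) : R :=
  let e := expR (- (2 * (mu * n%:R))) in
  c * (e / (1 + e)) + b * (n%:R * (e / (1 + e) ^+ 2)).

Section ExpoTerm.
Context {R : realType}.
Implicit Types (a b c mu nu : R) (s : seq R).

Let E mu (n : nat) : R := expR (- (2 * (mu * n%:R))).

Let cvg_eq_lim (f : nat -> R) (x y : R) :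
  x = y -> f n @[n --> \oo] --> x -> f n @[n --> \oo] --> y.
Proof. by move=> ->. Qed.

Let E_cvg0 mu : 0 < mu -> E mu n @[n --> \oo] --> (0 : R).
Proof.
by move=> mu0; under eq_fun do rewrite /E mulrA; apply: cvg_expRNM; rewrite mulr_gt0.
Qed.

Let nE_cvg0 mu : 0 < mu -> n%:R * E mu n @[n --> \oo] --> (0 : R).
Proof.
by move=> mu0; under eq_fun do rewrite /E mulrA; apply: cvg_natr_expRNM; rewrite mulr_gt0.
Qed.

Let E1V_cvg1 mu : 0 < mu -> (1 + E mu n)^-1 @[n --> \oo] --> (1 : R).
Proof.
move=> mu0; apply: (cvg_eq_lim _ _ _ (invr1 R)); apply: cvgV; first exact: oner_neq0.
by apply: (cvg_eq_lim _ _ _ (addr0 _)); apply: cvgD; [exact: cvg_cst | exact: E_cvg0].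
Qed.

(** Rescaling by [exp (2 mu n)] leaves a decay of rate [2 (nu - mu)], enough to beat the factor [n].
    The case [mu = 0] gives the decay of the term itself. *)
Lemma expo_term_cvg0 c b mu nu : 0 < nu -> mu < nu ->
  expo_term c b nu n * expR (2 * (mu * n%:R)) @[n --> \oo] --> (0 : R).
Proof.
move=> nu0 lt; have d0 : 0 < nu - mu by rewrite subr_gt0.
have -> : (fun n => expo_term c b nu n * expR (2 * (mu * n%:R))) =
    (fun n => c * (E (nu - mu) n * (1 + E nu n)^-1) +
              b * (n%:R * E (nu - mu) n * ((1 + E nu n)^-1 * (1 + E nu n)^-1))).
  apply/funext => n; rewrite /expo_term /=.
  have -> : E (nu - mu) n = E nu n * expR (2 * (mu * n%:R)).
    by rewrite -expRD; congr expR; ring.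
  rewrite -/(E nu n) -invfM -expr2; ring.
have z : c * (0 * 1) + b * (0 * (1 * 1)) = 0 :> R by rewrite !mul0r !mulr0 addr0.
apply: (cvg_eq_lim _ _ _ z); apply: cvgD; apply: cvgMr; apply: cvgM.
- exact: E_cvg0.
- exact: E1V_cvg1.
- exact: nE_cvg0.
- by apply: cvgM; apply: E1V_cvg1.
Qed.

Lemma expo_term_equiv c b mu : 0 < mu ->
  expo_term c b mu n * expR (2 * (mu * n%:R)) - (c + b * n%:R) @[n --> \oo] --> (0 : R).
Proof.
move=> mu0.
(* Since [(1 + E)^-2 - 1 = E (-2 - E) (1 + E)^-2], the error multiplying [b] keeps a factor [n E],
   which tends to 0. *)
have -> : (fun n => expo_term c b mu n * expR (2 * (mu * n%:R)) - (c + b * n%:R)) =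
    (fun n => c * ((1 + E mu n)^-1 - 1) +
       b * (n%:R * E mu n * ((- 2 - E mu n) * ((1 + E mu n)^-1 * (1 + E mu n)^-1)))).
  apply/funext => n; rewrite /expo_term /= -/(E mu n).
  have e1 : E mu n * expR (2 * (mu * n%:R)) = 1 by rewrite -expRD addNr expR0.
  have n0 : 1 + E mu n != 0 by rewrite lt0r_neq0 // addr_gt0 ?expR_gt0.
  have e2 : expR (2 * (mu * n%:R)) = (E mu n)^-1.
    by rewrite /E expRN invrK.
  rewrite e2; have n1 : E mu n != 0 by rewrite lt0r_neq0 ?expR_gt0.
  by field; rewrite n0 n1.
have z : c * (1 - 1) + b * (0 * ((- 2 - 0) * (1 * 1))) = 0 :> R.
  by rewrite subrr !mul0r !mulr0 addr0.
apply: (cvg_eq_lim _ _ _ z); apply: cvgD; apply: cvgMr.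
- by apply: cvgB; [exact: E1V_cvg1 | exact: cvg_cst].
- apply: cvgM; first exact: nE_cvg0.
  apply: cvgM; last by apply: cvgM; apply: E1V_cvg1.
  by apply: cvgB; [exact: cvg_cst | exact: E_cvg0].
Qed.

Let sum_cvg0 s (f : R -> nat -> R) :
  (forall nu, nu \in s -> f nu n @[n --> \oo] --> 0) ->
  \sum_(nu <- s) f nu n @[n --> \oo] --> (0 : R).
Proof.
elim: s => [|nu s IH] fs.
  by under eq_fun do rewrite big_nil; exact: cvg_cst.
under eq_fun do rewrite big_cons.
apply: (cvg_eq_lim _ _ _ (addr0 _)); apply: cvgD; first by apply: fs; rewrite mem_head.
by apply: IH => xi xis; apply: fs; rewrite inE xis orbT.
Qed.

(* The slowest exponential dominates the others, so its coefficients vanish first. *)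
Lemma expo_terms_independent s C B (c b : R -> R) :
  sorted <%R s -> all (fun mu => 0 < mu) s ->
  (forall n, C + B * n%:R + \sum_(mu <- s) expo_term (c mu) (b mu) mu n = 0) ->
  (C = 0 /\ B = 0) /\ forall mu, mu \in s -> c mu = 0 /\ b mu = 0.
Proof.
elim: s => [|mu s IH] srt pos rel.
  split => //; apply: (@affine_cvg0 _ C B (fun=> 0)); last exact: cvg_cst.
  by move=> n; have := rel n; rewrite big_nil.
have [C0 B0] : C = 0 /\ B = 0.
  apply: (@affine_cvg0 _ C B (fun n => \sum_(nu <- mu :: s) expo_term (c nu) (b nu) nu n)) => //.
  apply: sum_cvg0 => nu nus; have nu0 := allP pos _ nus.
  have := expo_term_cvg0 (c nu) (b nu) 0 nu nu0 nu0.
  by under eq_fun do rewrite mul0r mulr0 expR0 mulr1.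
move: pos => /= /andP[mu0 pos].
have ltmu := allP (order_path_min lt_trans srt).
(* Multiplied by [exp (2 mu n)], with [mu] the smallest frequency, the relation reads
   [c mu + b mu * n + o(1) = 0]. *)
have [cmu bmu] : c mu = 0 /\ b mu = 0.
  apply: (@affine_cvg0 _ (c mu) (b mu) (fun n =>
    (expo_term (c mu) (b mu) mu n * expR (2 * (mu * n%:R)) - (c mu + b mu * n%:R)) +
    \sum_(nu <- s) expo_term (c nu) (b nu) nu n * expR (2 * (mu * n%:R)))).
    move=> n; have := rel n; rewrite C0 B0 mul0r !add0r big_cons => reln.
    by rewrite addrA addrCA subrr addr0 -mulr_suml -mulrDl reln mul0r.
  apply: (cvg_eq_lim _ _ _ (addr0 _)); apply: cvgD; first exact: expo_term_equiv.
  by apply: sum_cvg0 => nu nus; apply: expo_term_cvg0 (ltmu _ nus); apply: (allP pos).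
have [_ h] : (C = 0 /\ B = 0) /\ forall nu, nu \in s -> c nu = 0 /\ b nu = 0.
  apply: IH => //; first exact: path_sorted srt.
  move=> n; have := rel n; rewrite big_cons.
  by rewrite {1}/expo_term cmu bmu !mul0r !add0r.
by split => // nu; rewrite inE => /predU1P[->|]//; apply: h.
Qed.

End ExpoTerm.

(** Grouping the terms of nonzero frequency by [|mu i|] gives distinct positive frequencies,
    whatever coincidences occur away from [i0]; the isolated [i0] forms a group of its own. *)
Lemma tanh_independent {R : realType} (I : finType) (mu c b : I -> R) (i0 : I) :
  mu i0 != 0 -> (forall i, i != i0 -> `|mu i| != `|mu i0|) ->
  (forall t, \sum_i (c i * tanh (mu i * t) + b i * (t * sech2 (mu i * t))) = 0) ->
  c i0 = 0 /\ b i0 = 0.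
Proof.
move=> mu0 sep rel.
pose s := sort <=%R (undup [seq `|mu i| | i <- enum I & mu i != 0]).
have memE i : mu i != 0 -> `|mu i| \in s.
  by move=> mi; rewrite mem_sort mem_undup; apply: map_f; rewrite mem_filter mi mem_enum.
have us : uniq s by rewrite sort_uniq undup_uniq.
have srt : sorted <%R s by rewrite lt_sorted_uniq_le us sort_sorted //; exact: le_total.
have pos : all (fun nu => 0 < nu) s.
  apply/allP => nu; rewrite mem_sort mem_undup => /mapP[i].
  by rewrite mem_filter => /andP[mi _] ->; rewrite normr_gt0.
(* The factors -2 and 4 come from the exponential forms of [tanh] and [sech2]; a sign appears only
   in [cc] because [tanh] is odd and [sech2] even. *)
pose cc nu := \sum_(i | `|mu i| == nu) (- 2 * (Num.sg (mu i) * c i)).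
pose bb nu := \sum_(i | `|mu i| == nu) (4 * b i).
have termE i (n : nat) : mu i != 0 ->
    c i * tanh (mu i * n%:R) + b i * (n%:R * sech2 (mu i * n%:R)) =
    Num.sg (mu i) * c i +
    expo_term (- 2 * (Num.sg (mu i) * c i)) (4 * b i) `|mu i| n.
  move=> mi.
  have -> : tanh (mu i * n%:R) = Num.sg (mu i) * tanh (`|mu i| * n%:R).
    rewrite {1}[mu i]numEsg -mulrA; case: sgrP => // _; rewrite ?mul1r ?mul0r ?tanh0 //.
    by rewrite !mulN1r tanhN.
  have -> : sech2 (mu i * n%:R) = sech2 (`|mu i| * n%:R).
    rewrite {1}[mu i]numEsg -mulrA; case: sgrP mi => // _ _; rewrite ?mul1r //.
    by rewrite !mulN1r sech2N.
  by rewrite tanhE_expR sech2E_expR /expo_term /=; ring.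
have sumE n : \sum_(nu <- s) expo_term (cc nu) (bb nu) nu n =
    \sum_(i | mu i != 0) expo_term (- 2 * (Num.sg (mu i) * c i)) (4 * b i) `|mu i| n.
  under eq_bigr do rewrite /expo_term /= /cc /bb !mulr_suml -big_split /=.
  rewrite (exchange_big_dep xpredT) //= [RHS]big_mkcond /=; apply: eq_bigr => i _.
  case: ifPn => [mi|]; last first.
    rewrite negbK => /eqP mi; rewrite big_seq_cond big_pred0 // => nu.
    apply/negbTE/negP => /andP[nus]; rewrite mi normr0 => /eqP nu0.
    by have := allP pos _ nus; rewrite -nu0 ltxx.
  rewrite -big_filter (eq_filter (a2 := pred1 `|mu i|)); last by move=> nu; rewrite /= eq_sym.
  by rewrite filter_pred1_uniq ?memE // big_seq1.
(* [C] gathers the limits of the [tanh] terms at infinity. A zero frequency contributes only the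
   linear term [b i * sech2 0 * t], gathered in [B]. *)
pose C := \sum_(i | mu i != 0) Num.sg (mu i) * c i.
pose B := \sum_(i | ~~ (mu i != 0)) b i * sech2 0.
have key n : C + B * n%:R + \sum_(nu <- s) expo_term (cc nu) (bb nu) nu n = 0.
  rewrite -[RHS](rel n%:R) [RHS](bigID (fun i => mu i != 0)) /= sumE addrAC -big_split /=.
  congr (_ + _); first by apply: eq_bigr => i mi; rewrite termE.
  rewrite mulr_suml; apply: eq_bigr => i; rewrite negbK => /eqP ->.
  by rewrite mul0r tanh0 mulr0 add0r mulrAC mulrA.
have [_ /(_ _ (memE _ mu0))] := expo_terms_independent s C B cc bb srt pos key.
have only : (fun i => `|mu i| == `|mu i0|) =1 pred1 i0.
  by move=> i /=; case: (eqVneq i i0) => [->|/sep/negbTE->]; rewrite ?eqxx.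
rewrite /cc /bb !(big_pred1 i0) // => -[/eqP + /eqP].
by rewrite !mulf_eq0 oppr_eq0 sgr_eq0 (negbTE mu0) !pnatr_eq0 /= => /eqP -> /eqP ->.
Qed.

(** * Finite families of functions and their values at points *)

Definition independent {R : realType} {T : Type} {I : finType} (phi : I -> T -> R) :=
  forall c : I -> R, (forall x, \sum_i c i * phi i x = 0) -> forall i, c i = 0.

Lemma sum_enum_val {R : realType} {I : finType} (F : I -> R) :
  \sum_i F i = \sum_(j < #|I|) F (enum_val j).
Proof. exact: (reindex _ (onW_bij _ (@enum_val_bij I))). Qed.

(** Points are chosen one at a time: while the evaluation rows found so far do not span, some
    [v != 0] is orthogonal to them, and independence provides a point [x] with [F x *m v != 0]. *)
Lemma independent_points {R : realType} {T : Type} {I : finType} (phi : I -> T -> R) :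
  independent phi -> exists X : 'I_#|I| -> T,
    forall c, (forall l, \sum_i c i * phi i (X l) = 0) -> forall i, c i = 0.
Proof.
move=> ind; pose F x : 'rV[R]_#|I| := \row_j phi (enum_val j) x.
have [A Afree /choice[X AX]] : exists2 A : 'M[R]_#|I|, row_free A &
    forall l, exists x, row l A = F x.
  suff: forall n, (n <= #|I|)%N -> exists2 A : 'M[R]_(n, #|I|), row_free A &
    forall l, exists x, row l A = F x by apply.
  elim=> [|n IH] ltn.
    by exists 0 => [|[]//]; rewrite /row_free mxrank0.
  have [A Afree AF] := IH (ltnW ltn).
  have /eqP/matrixP : cokermx A != 0.
    rewrite cokermx_eq0 /row_full; move: Afree; rewrite /row_free => /eqP ->.
    by rewrite ltn_eqF.
  move=> K0; have [j vj0] : exists j, col j (cokermx A) != 0.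
    apply: contrapT => /forallNP h; apply: K0 => i j; rewrite mxE.
    by have /negP := h j; rewrite negbK => /eqP/matrixP/(_ i 0); rewrite !mxE.
  set v := col j _ in vj0.
  have Av : A *m v = 0 by rewrite /v colE mulmxA mulmx_coker mul0mx.
  have [x Fxv] : exists x, F x *m v != 0.
    apply: contrapT => /forallNP h; move/eqP: vj0; apply; apply/matrixP => i k.
    rewrite ord1 [RHS]mxE; have := ind (fun i => v (enum_rank i) 0) _ (enum_val i).
    rewrite enum_valK; apply => x; have /negP := h x; rewrite negbK => /eqP/matrixP/(_ 0 0).
    rewrite [LHS]mxE [RHS]mxE => e; rewrite -[RHS]e sum_enum_val; apply: eq_bigr => l _.
    by rewrite enum_valK !mxE mulrC.
  exists (col_mx (F x) A : 'M[R]_(1 + n, #|I|)).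
    apply: inj_row_free => w.
    have [a [r ->]] : exists (a : 'rV[R]_1) (r : 'rV[R]_n), w = row_mx a r.
      by exists (lsubmx (w : 'rV[R]_(1 + n))), (rsubmx (w : 'rV[R]_(1 + n))); rewrite hsubmxK.
    move=> e; have wA : a *m F x + r *m A = 0 by rewrite -mul_row_col; exact: e.
    have a0 : a = 0.
      have : (a *m F x + r *m A) *m v = 0 by rewrite wA mul0mx.
      rewrite mulmxDl -!mulmxA Av mulmx0 addr0 [a]mx11_scalar mul_scalar_mx.
      move/eqP; rewrite scaler_eq0 (negbTE Fxv) orbF => /eqP ->.
      by rewrite raddf0.
    move: wA; rewrite a0 mul0mx add0r => /eqP; rewrite mulmx_free_eq0 // => /eqP ->.
    exact: (row_mx0 R 1 1 n).
  move=> l; case: (split_ordP (l : 'I_(1 + n))) => l' ->.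
    by exists x; apply: etrans (rowKu l' (F x) A) _; rewrite ord1 row_id.
  by have [y e] := AF l'; exists y; apply: etrans (rowKd l' (F x) A) e.
exists X => c Xc i.
have : A *m (\col_j c (enum_val j)) = 0.
  apply/matrixP => l k; rewrite !mxE -[RHS](Xc l) [RHS]sum_enum_val.
  apply: eq_bigr => j _; have /matrixP/(_ 0 j) := AX l.
  by rewrite !mxE => ->; rewrite mulrC.
(* [A] is square with free rows, hence invertible, and it annihilates the vector of coefficients. *)
rewrite row_free_unit in Afree; move/(congr1 (mulmx (invmx A))); rewrite mulKmx // mulmx0.
by move/matrixP/(_ (enum_rank i) 0); rewrite !mxE enum_rankK.
Qed.

Lemma dependent_points {R : realType} {T : Type} {I : finType} (phi : I -> T -> R)
    (n : nat) (X : 'I_n -> T) : (n < #|I|)%N ->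
  exists c : I -> R, (exists i, c i != 0) /\ forall l, \sum_i c i * phi i (X l) = 0.
Proof.
move=> ltn; pose M := \matrix_(j < #|I|, l < n) phi (enum_val j) (X l).
have K0 : kermx M != 0.
  rewrite kermx_eq0 /row_free neq_ltn (leq_ltn_trans (rank_leq_col M)) //.
pose w := nz_row (kermx M).
have w0 : w != 0 by rewrite nz_row_eq0.
have /sub_kermxP wM : (w <= kermx M)%MS by apply: nz_row_sub.
exists (fun i => w 0 (enum_rank i)); split.
  apply: contrapT => /forallNP h; move/eqP: w0; apply; apply/rowP => j.
  by have /negP := h (enum_val j); rewrite negbK enum_valK mxE => /eqP.
move=> l; have /matrixP/(_ 0 l) := wM; rewrite !mxE => e.
by rewrite -[RHS]e sum_enum_val; apply: eq_bigr => j _; rewrite enum_valK mxE.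
Qed.

(** * Generic directions and isolated neurons *)

Lemma exists_nonroot {R : realType} (p : {poly R}) : p != 0 -> exists x, ~~ root p x.
Proof.
move=> p0; apply: contrapT => /forallNP h.
pose rs : seq R := [seq i%:R | i <- iota 0 (size p)].
have rsp : all (root p) rs by apply/allP => x _; have /negP := h x; rewrite negbK.
have urs : uniq rs.
  by rewrite map_inj_uniq ?iota_uniq // => i j /eqP; rewrite eqr_nat => /eqP.
by have := max_poly_roots p0 rsp urs; rewrite size_map size_iota ltnn.
Qed.

(* The moment curve leaves every finite union of hyperplanes. *)
Lemma generic_direction {R : realType} {d : nat} {J : finType} (z : J -> 'I_d -> R) :
  exists v : 'I_d -> R, forall j i, z j i != 0 -> dotp (z j) v != 0.
Proof.
pose p j : {poly R} := \sum_i z j i *: 'X^i.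
have pE j (i : 'I_d) : (p j)`_i = z j i.
  rewrite coef_sum (bigD1 i) //= coefZ coefXn eqxx mulr1 big1 ?addr0 // => i' ii'.
  by rewrite coefZ coefXn eq_sym (inj_eq val_inj) (negbTE ii') mulr0.
have : \prod_(j | p j != 0) p j != 0 by apply/prodf_neq0.
move=> /exists_nonroot[x]; rewrite /root horner_prod => /prodf_neq0 px.
exists (fun i => x ^+ i) => j i zji.
have /px : p j != 0 by apply: contra_neq zji => pj; rewrite -pE pj coef0.
rewrite horner_sum; congr (_ != 0); apply: eq_bigr => i' _.
by rewrite hornerZ hornerXn.
Qed.

Lemma dotpZr {R : realType} {d : nat} (w v : 'I_d -> R) (t : R) :
  dotp w (fun j => t * v j) = dotp w v * t.
Proof. by rewrite /dotp mulr_suml; apply: eq_bigr => j _; rewrite mulrCA mulrC. Qed.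

Lemma dotpN {R : realType} {d : nat} (w x : 'I_d -> R) :
  dotp (fun j => - w j) x = - dotp w x.
Proof. by rewrite /dotp -sumrN; apply: eq_bigr => j _; rewrite mulNr. Qed.

Lemma dotpD {R : realType} {d : nat} (u w x : 'I_d -> R) :
  dotp (fun j => u j + w j) x = dotp u x + dotp w x.
Proof. by rewrite /dotp -big_split; apply: eq_bigr => j _; rewrite mulrDl. Qed.

Lemma dotp0 {R : realType} {d : nat} (x : 'I_d -> R) : dotp (fun=> 0) x = 0.
Proof. by rewrite /dotp big1 // => j _; rewrite mul0r. Qed.

(** Restriction to a line [t v] turns the relation into one between functions of [t], to which
    [tanh_independent] applies if [v] is generic. *)
Lemma isolated_neuron {R : realType} {d : nat} {I : finType}
    (u : I -> 'I_d -> R) (c : I -> R) (b : I -> 'I_d -> R) (i0 : I) :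
  u i0 <> (fun=> 0) ->
  (forall i, i != i0 -> u i <> u i0 /\ u i <> (fun j => - u i0 j)) ->
  (forall x, \sum_i (c i * tanh (dotp (u i) x) + dotp (b i) x * sech2 (dotp (u i) x)) = 0) ->
  c i0 = 0 /\ b i0 = (fun=> 0).
Proof.
move=> u0 sep rel.
(* These vectors, when nonzero, must keep a nonzero product with [v]; the sums [u i + u i0] and
   differences [u i - u i0] keep the frequency of [i0] isolated up to sign. *)
pose z (j : option (option (bool * I))) := match j with
  | None => u i0
  | Some None => b i0
  | Some (Some (s, i)) => fun j => u i j + (-1) ^+ s * u i0 j
  end.
have [v vP] := generic_direction z.
have nzP (w : 'I_d -> R) : w <> (fun=> 0) -> exists j, w j != 0.
  move=> w0; apply: contrapT => /forallNP h; apply: w0; apply/funext => j.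
  by have /negP := h j; rewrite negbK => /eqP.
have mu0 : dotp (u i0) v != 0 by have [j /(vP None)] := nzP _ u0.
have [||c0 b0] := tanh_independent I (fun i => dotp (u i) v) c (fun i => dotp (b i) v) i0 mu0.
- move=> i /sep[d1 d2].
  have h (s : bool) : dotp (u i) v + (-1) ^+ s * dotp (u i0) v != 0.
    have [|j /(vP (Some (Some (s, i))))] := nzP (z (Some (Some (s, i)))).
      move=> e.
      case: s e => e; [apply: d1 | apply: d2]; apply/funext => j; have := congr1 (@^~ j) e;
        rewrite /= ?expr1 ?mulN1r ?expr0 ?mul1r => /eqP; rewrite ?subr_eq0 ?addr_eq0 => /eqP //.
    rewrite /= dotpD; congr (_ + _ != 0).
    by rewrite /dotp mulr_sumr; apply: eq_bigr => k _; rewrite mulrA.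
  have := h false; have := h true; rewrite expr1 expr0 mulN1r mul1r subr_eq0 addr_eq0.
  move=> h1 h2; apply/eqP => /(congr1 (fun x => x ^+ 2)) /eqP.
  by rewrite !real_normK ?num_real // eqf_sqr (negbTE h1) (negbTE h2).
- move=> t; rewrite -[RHS](rel (fun j => t * v j)); apply: eq_bigr => i _.
  by rewrite !dotpZr mulrA.
(* One direction suffices to recover the vector [b i0]: if it were nonzero, so would be its product
   with [v]. *)
split=> //; apply: contrapT => /nzP[j /(vP (Some None))].
by rewrite b0 eqxx.
Qed.

(** * Partial derivatives of the model and interpolating minimizers *)

Lemma sum_option {R : realType} {J : finType} (F : option J -> R) :
  \sum_o F o = F None + \sum_j F (Some j).
Proof.
rewrite (bigD1 None) //=; congr (_ + _).
rewrite (reindex_omap Some id) /=; last by case.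
by apply: eq_bigl => j; rewrite eqxx.
Qed.

Lemma dAE {R : realType} {m d : nat} (a : 'I_m -> R) (w : 'I_m -> 'I_d -> R)
    (i : 'I_m) (x : 'I_d -> R) :
  dA a w i x = tanh (dotp (w i) x).
Proof.
rewrite /dA -[RHS](derive1_affine (nn a w x)); congr (derive1 _ 0).
apply/funext => t; rewrite /model /nn [in RHS](bigD1 i) //= [LHS](bigD1 i) //= eqxx mul1r.
rewrite (eq_bigr (fun i' => a i' * tanh (dotp (w i') x))); first by ring.
by move=> i' /negbTE ->; rewrite mul0r addr0.
Qed.

Lemma dWE {R : realType} {m d : nat} (a : 'I_m -> R) (w : 'I_m -> 'I_d -> R)
    (i : 'I_m) (j : 'I_d) (x : 'I_d -> R) :
  dW a w i j x = a i * (x j * sech2 (dotp (w i) x)).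
Proof.
rewrite /dW -(derive1_affine_tanh (\sum_(i' | i' != i) a i' * tanh (dotp (w i') x))).
congr (derive1 _ 0); apply/funext => t; rewrite /model /nn (bigD1 i) //= addrC.
congr (_ + _ * tanh _).
  apply: eq_bigr => i' /negbTE ->; congr (_ * tanh _).
  by apply: eq_bigr => j' _; rewrite mul0r addr0.
rewrite /dotp (bigD1 j) //= [in RHS](bigD1 j) //= !eqxx mul1r.
rewrite (eq_bigr (fun j' => w i j' * x j')); first by ring.
by move=> j' /negbTE ->; rewrite mul0r addr0.
Qed.

(** The member [fs] of [S] has loss 0, so the minimum is 0, and a sum of nonnegative terms vanishes
    only if each one does. *)
Lemma minimizers_interpolate {R : realType} (l : R -> R -> R) (d n : nat)
    (X : 'I_n -> 'I_d -> R) (fs : ('I_d -> R) -> R) (S : set (('I_d -> R) -> R)) :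
  (forall u v, 0 <= l u v) -> (forall u v, l u v = 0 <-> u = v) -> S fs ->
  minimizers (emp_loss l X fs) S = [set u | S u /\ forall i, u (X i) = fs (X i)].
Proof.
move=> l0 lE Sfs.
have pos u : 0 <= emp_loss l X fs u.
  rewrite /emp_loss; case: ifP => // _; rewrite mulr_ge0 ?invr_ge0 //.
  by apply: sumr_ge0.
have zeroP u : emp_loss l X fs u = 0 <-> forall i, u (X i) = fs (X i).
  (* For [n = 0] the loss is 0 by convention and there is no point to interpolate, so both sides
     hold. *)
  rewrite /emp_loss; case: eqP => [n0|/eqP n0].
    by split=> // _ i; have := ltn_ord i; rewrite [X in (_ < X)%N]n0.
  split=> [/eqP|h].
    rewrite mulf_eq0 invr_eq0 pnatr_eq0 (negbTE n0) psumr_eq0 //= => /allP h i.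
    by apply/lE/eqP; apply: h; rewrite mem_index_enum.
  by rewrite big1 ?mulr0 // => i _; apply/lE.
have fs0 : emp_loss l X fs fs = 0 by apply/zeroP.
apply/seteqP; split=> u [Su h]; split=> //.
  by apply/zeroP/le_anti; rewrite pos andbT -fs0 h.
by move=> v _; have /zeroP -> := h.
Qed.

(** * Minimal representations and recovery of their neurons *)

(** The degeneracies excluded are those of an odd activation: weight [0] gives the zero function,
    and opposite weights give opposite functions. *)
Definition separated {R : realType} {I : finType} {d : nat} (w : I -> 'I_d -> R) :=
  (forall i, w i <> (fun=> 0)) /\
  (forall i i', i' != i -> w i' <> w i /\ w i' <> (fun j => - w i j)).

Lemma FNN_drop {R : realType} {d k : nat} (a : 'I_k.+1 -> R) (w : 'I_k.+1 -> 'I_d -> R)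
    (i : 'I_k.+1) (r : 'I_k -> R) :
  (forall x, a i * tanh (dotp (w i) x) =
             \sum_(l < k) r l * tanh (dotp (w (lift i l)) x)) ->
  FNN d k (nn a w).
Proof.
move=> h; exists (fun l => r l + a (lift i l)), (fun l => w (lift i l)).
apply/funext => x; rewrite /nn (bigD1_ord i) //= h -big_split /=.
by apply: eq_bigr => l _; rewrite mulrDl.
Qed.

(** Each degeneracy would save one neuron: a zero neuron is dropped outright, a repeated or opposite
    one is merged with its twin. *)
Lemma minimal_separated {R : realType} {d k : nat} (a : 'I_k -> R) (w : 'I_k -> 'I_d -> R) :
  ~ FNN_pred d k (nn a w) -> (forall i, a i != 0) /\ separated w.
Proof.
case: k a w => [|k] a w /= notF; first by split; [case | split; case].
have drop0 i : (forall x, a i * tanh (dotp (w i) x) = 0) -> False.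
  move=> h; apply: notF; apply: (@FNN_drop _ _ _ _ _ i (fun=> 0)) => x.
  by rewrite h big1 // => l _; rewrite mul0r.
have dropS i i' (s : R) : i != i' ->
    (forall x, tanh (dotp (w i) x) = s * tanh (dotp (w i') x)) -> False.
  move=> /unlift_some[l ->] _ h; apply: notF.
  apply: (@FNN_drop _ _ _ _ _ i (fun l' => if l' == l then a i * s else 0)) => x.
  rewrite (bigD1 l) //= eqxx big1 ?addr0; last by move=> l' /negbTE ->; rewrite mul0r.
  by rewrite h mulrA.
split=> [i|].
  by apply/eqP => ai; apply: (drop0 i) => x; rewrite ai mul0r.
split=> [i wi|i i' ii'].
  by apply: (drop0 i) => x; rewrite wi dotp0 tanh0 mulr0.
split=> e; [apply: (dropS i' i 1 ii') | apply: (dropS i' i (-1) ii')] => x; rewrite e.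
  by rewrite mul1r.
by rewrite dotpN tanhN mulN1r.
Qed.

(** Otherwise [w i] would be isolated in the relation [nn a w - nn a' w' = 0], whence [a i = 0]. *)
Lemma neuron_recovered {R : realType} {d k m : nat} (a : 'I_k -> R) (w : 'I_k -> 'I_d -> R)
    (a' : 'I_m -> R) (w' : 'I_m -> 'I_d -> R) (i : 'I_k) :
  separated w -> a i != 0 -> nn a' w' = nn a w ->
  exists i', a' i' != 0 /\ (w' i' = w i \/ w' i' = (fun j => - w i j)).
Proof.
move=> [w0 wsep] ai e; apply: contrapT => /forallNP h; move/eqP: ai; apply.
(* Neurons of zero output weight are moved to weight [0]: they contribute nothing, and their actual
   weight might coincide with [w i] up to sign. *)
pose u (s : 'I_k + 'I_m) := match s with
  | inl i => w i | inr i' => if a' i' == 0 then fun=> 0 else w' i' end.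
pose c (s : 'I_k + 'I_m) := match s with inl i => a i | inr i' => - a' i' end.
have [] // := @isolated_neuron _ _ _ u c (fun _ _ => 0) (inl i) (w0 i).
  case=> [i2|i2] /= ne; first by apply: wsep; apply: contra_neq ne => ->.
  case: ifPn => a0; split=> e2.
  - by apply: (w0 i); rewrite -e2.
  - by apply: (w0 i); apply/funext => j; apply: oppr_inj; rewrite oppr0 -(congr1 (@^~ j) e2).
  - by apply: (h i2); split => //; left.
  - by apply: (h i2); split => //; right.
move=> x; under eq_bigr do rewrite dotp0 mul0r addr0.
rewrite big_sumType /= -/(nn a w x) -e /nn -big_split big1 //= => i2 _.
by case: ifPn => [/eqP->|_]; rewrite ?oppr0 ?mul0r ?addr0 // mulNr subrr.
Qed.

(** * Independence of the tangent functions *)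

Definition tangent_vector {R : realType} {d k : nat} (a : 'I_k -> R) (w : 'I_k -> 'I_d -> R)
    (p : 'I_k * option 'I_d) (x : 'I_d -> R) : R :=
  if p.2 is Some j then dW a w p.1 j x else dA a w p.1 x.

Lemma sum_tangent_vector {R : realType} {d k : nat} (a : 'I_k -> R) (w : 'I_k -> 'I_d -> R)
    (c : 'I_k * option 'I_d -> R) (x : 'I_d -> R) :
  \sum_p c p * tangent_vector a w p x =
  \sum_i c (i, None) * dA a w i x + \sum_i \sum_j c (i, Some j) * dW a w i j x.
Proof.
transitivity (\sum_i \sum_o c (i, o) * tangent_vector a w (i, o) x).
  by rewrite pair_bigA; apply: eq_bigr => -[].
by rewrite -big_split; apply: eq_bigr => i _; rewrite sum_option.
Qed.

(** Separation isolates every neuron in turn. The factor [a i] of [dW] is moved into the coefficient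
    and cancelled at the end since [a i != 0]. *)
Lemma tangent_vector_independent {R : realType} {d k : nat}
    (a : 'I_k -> R) (w : 'I_k -> 'I_d -> R) :
  (forall i, a i != 0) -> separated w -> independent (tangent_vector a w).
Proof.
move=> a0 [w0 wsep] c rel.
suff h i : c (i, None) = 0 /\ (fun j => a i * c (i, Some j)) = (fun=> 0).
  move=> [i o]; have [cN cS] := h i; case: o => [j|] //.
  by apply/eqP; have /eqP := congr1 (@^~ j) cS; rewrite mulf_eq0 (negbTE (a0 i)).
apply: (@isolated_neuron _ _ _ w (fun i => c (i, None)) (fun i j => a i * c (i, Some j))) => //.
  exact: wsep.
move=> x; rewrite -[RHS](rel x) sum_tangent_vector -big_split; apply: eq_bigr => i' _ /=.
rewrite dAE /dotp mulr_suml; congr (_ + _); apply: eq_bigr => j _; rewrite dWE; ring.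
Qed.

Lemma card_tangent_index (k d : nat) : #|{: 'I_k * option 'I_d}| = (k * d.+1)%N.
Proof. by rewrite card_prod card_option !card_ord. Qed.

(** * Lower and upper bounds on the sample size *)

Lemma LLR_guarantee_lower {R : realType} (l : R -> R -> R) (m d k n : nat)
    (a : 'I_k -> R) (w : 'I_k -> 'I_d -> R) :
  (forall u v, 0 <= l u v) -> (forall u v, l u v = 0 <-> u = v) ->
  (forall i, a i != 0) -> separated w ->
  LLR_guarantee l m d n (nn a w) -> (k * d.+1 <= n)%N.
Proof.
move=> l0 lE a0 wsep [X [[a' w'] [/= e minE]]].
rewrite /Mset /= /model in e.
(* For each neuron of the minimal representation, [s] selects a copy up to sign with nonzero output
   weight. Sign changes preserve separation, so the tangent functions of these copies are
   independent. *)
have [s sP] := choice (fun i => neuron_recovered a w a' w' i wsep (a0 i) e).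
pose b i := a' (s i); pose v i := w' (s i).
have vsep : separated v.
  have [w0 wd] := wsep.
  split=> [i vi|i i' ii'].
    apply: (w0 i); apply/funext => j; have := congr1 (@^~ j) vi; rewrite /v /=.
    by case: (sP i) => _ [] -> /=; lra.
  have [d1 d2] := wd _ _ ii'; rewrite /v.
  case: (sP i) (sP i') => _ [] -> [_ []] ->; split=> e2 //;
    [apply: d2 | apply: d1 | apply: d1 | apply: d1 | apply: d2];
    apply/funext => j; have /= := congr1 (@^~ j) e2; lra.
have ind := tangent_vector_independent b v (fun i => (sP i).1) vsep.
rewrite leqNgt; apply/negP; rewrite -card_tangent_index => ltn.
have [c [[p cp] cX]] := dependent_points (tangent_vector b v) n X ltn.
have tan_fs : tangent a' w' (nn a w).
  exists (fun=> 0), (fun _ _ => 0); apply/funext => x; rewrite /model e.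
  rewrite !big1 ?addr0 // => i _; rewrite ?mul0r // big1 // => j _.
  by rewrite mul0r.
rewrite minimizers_interpolate // in minE.
(* [u] differs from [nn a w] by a tangent direction vanishing on the sample, so it is a minimizer
   too; uniqueness makes this direction zero, against [c p != 0]. *)
pose u x := nn a w x + \sum_p c p * tangent_vector b v p x.
have : u = nn a w.
  suff : [set nn a w] u by [].
  rewrite -minE; split=> [|i]; last by rewrite /u cX addr0.
  (* Coefficients are carried along [s] by summing over its fibres. *)
  exists (fun i' => \sum_(i | s i == i') c (i, None)).
  exists (fun i' j => \sum_(i | s i == i') c (i, Some j)).
  apply/funext => x; rewrite /u sum_tangent_vector addrA /model e.
  congr (_ + _ + _); rewrite (partition_big s xpredT) //=; apply: eq_bigr => i' _.
    by rewrite mulr_suml; apply: eq_bigr => i /eqP <-; rewrite !dAE.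
  rewrite exchange_big /=; apply: eq_bigr => j _.
  by rewrite mulr_suml; apply: eq_bigr => i /eqP <-; rewrite !dWE.
move=> eu; move/eqP: cp; apply; apply: ind => x.
by apply: (addrI (nn a w x)); rewrite addr0; exact: (congr1 (@^~ x) eu).
Qed.

Lemma LLR_guarantee_upper {R : realType} (l : R -> R -> R) (m d k : nat)
    (a : 'I_k -> R) (w : 'I_k -> 'I_d -> R) :
  (forall u v, 0 <= l u v) -> (forall u v, l u v = 0 <-> u = v) ->
  (forall i, a i != 0) -> separated w -> (k <= m)%N ->
  LLR_guarantee l m d (k * d.+1) (nn a w).
Proof.
move=> l0 lE a0 wsep /subnKC <-; set p := (m - k)%N.
pose pad (T : Type) (z : T) (f : 'I_k -> T) (i : 'I_(k + p)) :=
  if fintype.split i is inl i' then f i' else z.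
have padl T (z : T) f i : pad T z f (lshift p i) = f i.
  by rewrite /pad (unsplitK (inl i)).
have padr T (z : T) f i : pad T z f (rshift k i) = z.
  by rewrite /pad (unsplitK (inr i)).
(* Zero weights on both layers make the tangent directions of the extra neurons vanish. *)
pose a' := pad R 0 a; pose w' := pad _ (fun=> 0) w.
have sum_pad (F : 'I_(k + p) -> R) : (forall i, F (rshift k i) = 0) ->
    \sum_i F i = \sum_i F (lshift p i).
  by move=> h; rewrite big_split_ord /= [X in _ + X]big1 ?addr0.
have e : nn a' w' = nn a w.
  apply/funext => x; rewrite /nn sum_pad => [|i]; last by rewrite /a' padr mul0r.
  by apply: eq_bigr => i _; rewrite /a' /w' !padl.
(* The padding neurons contribute nothing, so every tangent direction at [(a', w')] is a combination
   of the [k * d.+1] tangent functions of the minimal representation. *)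
have tanE x cA cW : \sum_i cA i * dA a' w' i x + \sum_i \sum_j cW i j * dW a' w' i j x =
    \sum_q (if q.2 is Some j then cW (lshift p q.1) j else cA (lshift p q.1)) *
      tangent_vector a w q x.
  rewrite sum_tangent_vector /=; congr (_ + _); rewrite sum_pad => [|i].
  - by apply: eq_bigr => i _; rewrite !dAE /w' padl.
  - by rewrite dAE /w' padr dotp0 tanh0 mulr0.
  - by apply: eq_bigr => i _; apply: eq_bigr => j _; rewrite !dWE /a' /w' !padl.
  - by rewrite big1 // => j _; rewrite dWE /a' padr mul0r mulr0.
have [X XP] := independent_points _ (tangent_vector_independent a w a0 wsep).
rewrite -card_tangent_index; exists X, (a', w'); split => //=.
have tan_fs : tangent a' w' (nn a w).
  exists (fun=> 0), (fun _ _ => 0); apply/funext => x; rewrite /model e.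
  rewrite !big1 ?addr0 // => i _; rewrite ?mul0r // big1 // => j _.
  by rewrite mul0r.
rewrite minimizers_interpolate //; apply/seteqP; split => [u|u -> //].
move=> [[cA [cW uE]] uX].
(* A tangent function that fits the sample has a direction vanishing at all points of [X], so its
   coefficients on the minimal neurons are 0. *)
have c0 := XP (fun q => if q.2 is Some j then cW (lshift p q.1) j else cA (lshift p q.1)).
apply/funext => x; rewrite uE /model e -addrA tanE big1 ?addr0 // => q _.
rewrite c0 ?mul0r // => i; apply: (addrI (nn a w (X i))).
by rewrite addr0 -[RHS]uX uE /model e -addrA tanE.
Qed.

Theorem mainTheorem17 (R : realType) (l : R -> R -> R) (m d k : nat)
  (fs : ('I_d -> R) -> R) :
  admissible_loss l ->
  (k <= m)%N ->
  FNN d k fs -> ~ FNN_pred d k fs ->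
  optimistic_sample_size_is l m d fs (k * d.+1).
Proof.
move=> [l0 lE _ _ _] km [a [w ->]] /minimal_separated[a0 wsep].
split; first exact: LLR_guarantee_upper.
by move=> n; apply: LLR_guarantee_lower.
Qed.
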